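(* For every integer $n\geq 2$, \[ m_3(K_{1,2}, P_4, nK_2)= \left\lfloor \frac{2n}{3} \right\rfloor+1. \]
   Context: $K_{3\times t}$ denotes the complete 3-partite graph with three partite classes of size $t$. $m_3(G_1,G_2,G_3)$ is the smallest positive integer $t$ such that every 3-coloring of the edges of $K_{3\times t}$ contains, for some $i\in\{1,2,3\}$, a copy of $G_i$ all of whose edges have color $i$. $K_{1,2}$ is the path on 3 vertices, $P_4$ the path on 4 vertices, and $nK_2$ the matching of $n$ disjoint edges. *)

(* Defs.v *)
From mathcomp Require Import all_boot.

Set Implicit Arguments.
Unset Strict Implicit.
Unset Printing Implicit Defensive.

Record sgraph := SGraph {
  vertex :> finType;
  adj : rel vertex;
  adj_sym : symmetric adj;
  adj_irrefl : irreflexive adj }.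

Section CompleteMultipartite.
Variables j t : nat.

Definition multipartite_adj : rel ('I_j * 'I_t) := fun u v => u.1 != v.1.

Lemma multipartite_adj_sym : symmetric multipartite_adj.
Proof. by move=> u v; rewrite /multipartite_adj eq_sym. Qed.

Lemma multipartite_adj_irrefl : irreflexive multipartite_adj.
Proof. by move=> u; rewrite /multipartite_adj eqxx. Qed.

(* K_{j x t}: the first component of a vertex is its partite class. *)
Definition complete_multipartite : sgraph :=
  SGraph multipartite_adj_sym multipartite_adj_irrefl.

End CompleteMultipartite.

Section CompleteBipartite.
Variables a b : nat.

Definition bipartite_adj : rel ('I_a + 'I_b) := fun u v =>
  match u, v with
  | inl _, inr _ | inr _, inl _ => true
  | _, _ => false
  end.

Lemma bipartite_adj_sym : symmetric bipartite_adj.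
Proof. by move=> [u|u] [v|v]. Qed.

Lemma bipartite_adj_irrefl : irreflexive bipartite_adj.
Proof. by move=> [u|u]. Qed.

Definition complete_bipartite : sgraph :=
  SGraph bipartite_adj_sym bipartite_adj_irrefl.

End CompleteBipartite.

Section Path.
Variable n : nat.

Definition path_adj : rel 'I_n := fun u v => (u.+1 == v) || (v.+1 == u).

Lemma path_adj_sym : symmetric path_adj.
Proof. by move=> u v; rewrite /path_adj orbC. Qed.

Lemma path_adj_irrefl : irreflexive path_adj.
Proof. by move=> u; rewrite /path_adj orbb gtn_eqF. Qed.

(* P_n, where n is the number of vertices. *)
Definition path_graph : sgraph := SGraph path_adj_sym path_adj_irrefl.

End Path.

Section Matching.
Variable n : nat.

Definition matching_adj : rel ('I_n * bool) :=
  fun u v => (u.1 == v.1) && (u.2 != v.2).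

Lemma matching_adj_sym : symmetric matching_adj.
Proof. by move=> u v; rewrite /matching_adj eq_sym (eq_sym u.2). Qed.

Lemma matching_adj_irrefl : irreflexive matching_adj.
Proof. by move=> u; rewrite /matching_adj !eqxx. Qed.

(* n K_2: the i-th edge joins (i, false) and (i, true). *)
Definition matching_graph : sgraph :=
  SGraph matching_adj_sym matching_adj_irrefl.

End Matching.

(* An edge uv is the set [set u; v]. A k-coloring of the edges of H is given
   by a function on all vertex sets; its values off the edges are never used. *)
Definition mono_copy (k : nat) (H : sgraph) (c : {set H} -> 'I_k) (i : 'I_k)
    (G : sgraph) : Prop :=
  exists2 f : G -> H, injective f &
    forall x y : G, adj x y -> adj (f x) (f y) /\ c [set f x; f y] = i.

Definition arrows (k : nat) (H : sgraph) (G : 'I_k -> sgraph) : Prop :=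
  forall c : {set H} -> 'I_k, exists i : 'I_k, mono_copy c i (G i).

Definition graphs3 (G1 G2 G3 : sgraph) : 'I_3 -> sgraph := fun i =>
  match val i with 0 => G1 | 1 => G2 | _ => G3 end.

(* m_j(G_1, ..., G_k) = t, the existence of the minimum being part of the
   assertion. *)
Definition is_multipartite_ramsey (j k : nat) (G : 'I_k -> sgraph) (t : nat) :
    Prop :=
  [/\ 0 < t, arrows (complete_multipartite j t) G &
      forall s : nat, 0 < s -> arrows (complete_multipartite j s) G -> t <= s].

(* Main.v *)
Require Import Defs.
From mathcomp Require Import all_boot zify.

Set Implicit Arguments.
Unset Strict Implicit.
Unset Printing Implicit Defensive.

(* Call the colours red, green and blue.  Lower bound: if [3 * s <= 2 * n], colour
   all edges at one vertex green and the others blue; the blue edges then live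
   on fewer than [2 * n] vertices.  Upper bound: red is a matching and the
   components of green are stars and triangles, so we look for a blue matching
   leaving at most two vertices uncovered.  A maximum blue matching has this
   property as soon as the vertices of large green degree are centres of stars,
   which fails only if [t] is 2 or 3 and there is a green triangle.  A green
   triangle sends no green edge to the other vertices, so it is joined to them
   by blue edges up to a matching; this gives the blue edges required. *)

(** * Matchings as involutions *)

Section Matchings.
Variables (V : finType) (r : rel V).
Hypotheses (r_sym : symmetric r) (r_irr : irreflexive r).
Implicit Types (p : {ffun V -> V}) (x y a : V).

(* A matching is an involution exchanging the ends of each of its edges; the
   uncovered vertices are its fixed points. *)
Definition is_matching p : bool :=
  [forall v, (p (p v) == v) && ((p v == v) || r v (p v))].

Definition unmatched p : {set V} := [set v | p v == v].

Lemma matchingK p : is_matching p -> involutive p.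
Proof. by move=> /forallP pm v; case/andP: (pm v) => /eqP. Qed.

Lemma matching_edge p v : is_matching p -> p v != v -> r v (p v).
Proof. by move=> /forallP/(_ v)/andP[_ /orP[->|]]. Qed.

(** Augmentation by a single edge; it shows that the vertices left uncovered by a maximum matching
    are pairwise non-adjacent. *)
Lemma matching_join p x y : is_matching p ->
    x \in unmatched p -> y \in unmatched p -> r x y ->
  exists2 q, is_matching q & unmatched q = unmatched p :\ x :\ y.
Proof.
move=> pm; rewrite !inE => /eqP px /eqP py rxy.
have pK := matchingK pm.
have xy : x != y by apply: contraTneq rxy => ->; rewrite r_irr.
pose q := [ffun v => if v == x then y else if v == y then x else p v].
have qx : q x = y by rewrite ffunE eqxx.
have qy : q y = x by rewrite ffunE eq_sym (negPf xy) eqxx.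
have qv v : v != x -> v != y -> q v = p v.
  by move=> /negPf vx /negPf vy; rewrite ffunE vx vy.
have pv v u : p u = u -> v != u -> p v != u.
  by move=> pu; rewrite -{2}pu (inj_eq (inv_inj pK)).
exists q.
  apply/forallP => v.
  have [->|vx] := eqVneq v x; first by rewrite qx qy eqxx rxy orbT.
  have [->|vy] := eqVneq v y; first by rewrite qy qx eqxx r_sym rxy orbT.
  rewrite (qv v) // qv ?pv // pK eqxx /=.
  by have [//|/(matching_edge pm)] := eqVneq.
apply/setP => v; rewrite !inE.
have [->|vy] := eqVneq v y; first by rewrite qy (negPf xy).
have [->|vx] := eqVneq v x; first by rewrite qx eq_sym (negPf xy).
by rewrite qv.
Qed.

(** The edge between [a] and [p a] is exchanged for the edge between [x] and [a], so [p a] takes the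
    place of [x] among the uncovered vertices. *)
Lemma matching_rotate p x a : is_matching p ->
    x \in unmatched p -> a \notin unmatched p -> r x a ->
  exists2 q, is_matching q & unmatched q = p a |: unmatched p :\ x.
Proof.
move=> pm; rewrite !inE => /eqP px pa rxa.
have pK := matchingK pm.
have xa : x != a by apply: contraTneq rxa => ->; rewrite r_irr.
have xpa : x != p a by apply: contraNneq xa => E; rewrite -(pK a) -E px.
pose q := [ffun v => if v == x then a else if v == a then x
                     else if v == p a then v else p v].
have qx : q x = a by rewrite ffunE eqxx.
have qa : q a = x by rewrite ffunE eq_sym (negPf xa) eqxx.
have qpa : q (p a) = p a.
  by rewrite ffunE eq_sym (negPf xpa) (negPf pa) eqxx.
have qv v : v != x -> v != a -> v != p a -> q v = p v.
  by move=> /negPf vx /negPf va /negPf vpa; rewrite ffunE vx va vpa.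
have pv v u : v != u -> p v != p u by rewrite (inj_eq (inv_inj pK)).
exists q.
  apply/forallP => v.
  have [->|vx] := eqVneq v x; first by rewrite qx qa eqxx rxa orbT.
  have [->|va] := eqVneq v a; first by rewrite qa qx eqxx r_sym rxa orbT.
  have [->|vpa] := eqVneq v (p a); first by rewrite !qpa eqxx.
  rewrite (qv v) // qv; last first.
  - exact: pv.
  - by rewrite -(pK a) pv.
  - by rewrite -px pv.
  rewrite pK eqxx /=.
  by have [//|/(matching_edge pm)] := eqVneq.
apply/setP => v; rewrite !inE.
have [->|vpa] := eqVneq v (p a); first by rewrite qpa eqxx.
have [->|vx] := eqVneq v x; first by rewrite qx eq_sym (negPf xa).
have [->|va] := eqVneq v a; first by rewrite qa (negPf xa) (negPf pa).
by rewrite qv.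
Qed.

(* One representative of each edge is selected by comparing enumeration ranks. *)
Lemma matching_half p : is_matching p ->
  exists A : {set V}, [/\ #|A|.*2 = #|V| - #|unmatched p|,
    {in A, forall v, r v (p v)} & {in A &, forall u v, u != p v}].
Proof.
move=> pm; have pK := matchingK pm.
pose A := [set v | enum_rank v < enum_rank (p v)].
exists A; split.
- have AI : A :&: p @: A = set0.
    apply/setP => v; rewrite !inE; apply/negP => /andP[lt_v].
    by move=> /imsetP[u]; rewrite inE => lt_u vE; move: lt_v; rewrite vE pK; lia.
  have AU : A :|: p @: A = ~: unmatched p.
    apply/setP => v; rewrite !inE.
    have -> : (v \in p @: A) = (p v \in A).
      by rewrite -{1}(pK v) mem_imset //; apply: inv_inj.
    rewrite inE pK -neq_ltn; congr negb.
    by apply/eqP/eqP => [/val_inj/enum_rank_inj|->].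
  rewrite -addnn -{2}(card_imset A (inv_inj pK)).
  by rewrite -cardsUI AI cards0 addn0 AU cardsCs setCK.
- move=> v; rewrite inE => lt_v; apply: (matching_edge pm).
  by apply: contraTneq lt_v => ->; rewrite ltnn.
- move=> u v; rewrite !inE => lt_u lt_v; apply: contraTneq lt_u => ->.
  by rewrite pK; lia.
Qed.

End Matchings.

(** * Degrees and near-perfect matchings *)

Section Degrees.
Variables (V : finType).
Implicit Types (r : rel V) (v : V).

Definition nbh r v : {set V} := [set u | r v u].
Definition deg r v := #|nbh r v|.

Lemma deg_gt1 r v a b : r v a -> r v b -> a != b -> 1 < deg r v.
Proof.
by move=> va vb ab; apply/card_gt1P; exists a, b; split; rewrite ?inE.
Qed.

Variable r : rel V.
Hypotheses (r_sym : symmetric r) (r_irr : irreflexive r).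

(** Double counting: the closed neighbourhoods of the vertices of [H] are pairwise disjoint. If two
    of them met, either their centres would be adjacent, or a neighbour of a centre would have
    degree at least 2. *)
Lemma sum_closed_nbh (H : {set V}) :
    {in H, forall v, 1 < deg r v /\ forall u, r v u -> deg r u <= 1} ->
  \sum_(v in H) (deg r v).+1 <= #|V|.
Proof.
move=> Hhub.
have cE v : (deg r v).+1 = \sum_u (u \in v |: nbh r v).
  by rewrite -big_mkcond sum1_card cardsU1 inE r_irr.
rewrite (eq_bigr _ (fun v _ => cE v)) exchange_big /= -sum1_card leq_sum // => u _.
rewrite -big_mkcondr sum1_card; apply/card_le1_eqP => v w.
move=> /andP[/Hhub[v1 vn] vu] /andP[/Hhub[w1 wn] wu].
move: vu wu; rewrite !inE => vu wu.
apply/eqP; apply: contraTT v1 => nvw; rewrite -leqNgt.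
case/orP: wu => [/eqP uw|rwu].
  case/orP: vu => [/eqP uv|rvu]; first by rewrite -uv uw eqxx in nvw.
  by move: w1; rewrite ltnNge -uw vn.
case/orP: vu => [/eqP <-|rvu]; first exact: wn.
have := wn _ rwu; rewrite leqNgt (deg_gt1 (r:=r) (a:=v) (b:=w)) //.
- by rewrite r_sym.
- by rewrite r_sym.
- by rewrite eq_sym.
Qed.

End Degrees.

(* Among the maximum matchings of [e3] take one leaving as few hubs (vertices
   of [e2]-degree at least [k]) uncovered as possible.  If [x] and [z] are
   uncovered, the [e3]-neighbours of [x] and the partners of those of [z] are
   disjoint, so the [e2]-degrees of [x] and [z] add up to more than [t].  Hence
   two hubs [x], [y] are uncovered if three vertices are.  Exchanging [x] with
   the partner of an [e3]-neighbour shows that this partner is a hub; this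
   gives more hubs than the disjoint closed [e2]-neighbourhoods leave room for. *)
Lemma near_perfect_matching (V : finType) (e2 e3 : rel V) (t k : nat) :
    symmetric e2 -> irreflexive e2 -> symmetric e3 -> irreflexive e3 ->
    #|V| = 3 * t -> 1 < k -> 2 * k.-1 <= t ->
    (forall v, 2 * t <= (deg e2 v + deg e3 v).+1) ->
    (forall v u, k <= deg e2 v -> e2 v u -> deg e2 u <= 1) ->
  exists2 p, is_matching e3 p & #|unmatched p| <= 2.
Proof.
move=> s2 i2 s3 i3 cV k1 kt dge hub.
pose H := [set v | k <= deg e2 v].
(* The factor exceeds any number of uncovered hubs, so minimizing [mu] is lexicographic: first the
   uncovered vertices, then the hubs among them. *)
pose mu (p : {ffun V -> V}) :=
  #|unmatched p| * (#|V|.+1) + #|unmatched p :&: H|.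
have m0 : is_matching e3 (finfun id) by apply/forallP => v; rewrite !ffunE eqxx.
case: (arg_minnP mu m0) => p pm pmin; exists p => //.
rewrite leqNgt; apply/negP => U3.
have HleV q : #|unmatched q :&: H| <= #|V| := max_card _.
have Umin q : is_matching e3 q -> #|unmatched p| <= #|unmatched q|.
  move=> qm; have := pmin q qm; rewrite /mu; have := HleV q; nia.
have Hmin q : is_matching e3 q -> #|unmatched q| = #|unmatched p| ->
    #|unmatched p :&: H| <= #|unmatched q :&: H|.
  by move=> qm qU; have := pmin q qm; rewrite /mu qU leq_add2l.
have noedge q x y : is_matching e3 q -> #|unmatched q| = #|unmatched p| ->
    x \in unmatched q -> y \in unmatched q -> ~~ e3 x y.
  move=> qm qU xU yU; apply/negP => xy.
  have [q' qm' q'U] := matching_join s3 i3 qm xU yU xy.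
  have := Umin q' qm'; rewrite q'U -qU (cardsD1 x (unmatched q)) xU.
  have := subset_leq_card (subD1set (unmatched q :\ x) y); lia.
have pK := matchingK pm.
have pU a : (p a \in unmatched p) = (a \in unmatched p).
  by rewrite !inE (inj_eq (inv_inj pK)).
have cov x a : x \in unmatched p -> e3 x a -> a \notin unmatched p.
  by move=> xU; apply: contraL; apply: noedge.
have rot x a : x \in unmatched p -> e3 x a ->
    exists q, [/\ is_matching e3 q, unmatched q = p a |: unmatched p :\ x
                & #|unmatched q| = #|unmatched p|].
  move=> xU xa; have aU := cov _ _ xU xa.
  have [q qm qU] := matching_rotate s3 i3 pm xU aU xa.
  exists q; split=> //; rewrite qU cardsU1 !in_setD1 pU (negPf aU) andbF.
  by rewrite (cardsD1 x (unmatched p)) xU.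
(* A common element [a] would give the augmenting path [x], [a], [p a], [z]: rotating [x] onto [a]
   leaves the adjacent vertices [p a] and [z] uncovered. *)
have dis x z : x \in unmatched p -> z \in unmatched p -> x != z ->
    [disjoint nbh e3 x & p @: nbh e3 z].
  move=> xU zU xz; rewrite -setI_eq0; apply/eqP/setP => a; rewrite !inE.
  apply/negP => /andP[xa /imsetP[b]]; rewrite inE => zb ab.
  have [q [qm qU qc]] := rot _ _ xU xa.
  suff: ~~ e3 z (p a) by rewrite ab pK zb.
  by apply: (noedge q); rewrite // qU in_setU1 ?eqxx // in_setD1 (eq_sym z x) xz zU orbT.
(* The two disjoint sets lie among at most [3 * t - 3] covered vertices, while by [dge] the four
   degrees add up to at least [4 * t - 2]. *)
have dsum x z : x \in unmatched p -> z \in unmatched p -> x != z ->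
    t < deg e2 x + deg e2 z.
  move=> xU zU xz.
  have sub : nbh e3 x :|: p @: nbh e3 z \subset ~: unmatched p.
    apply/subsetP => a; rewrite in_setC in_setU => /orP[|/imsetP[b zb ->]].
      by rewrite inE; apply: cov.
    by rewrite pU; move: zb; rewrite inE; apply: cov.
  have := subset_leq_card sub.
  rewrite cardsU disjoint_setI0 ?dis // cards0 subn0 card_imset; last exact: inv_inj.
  rewrite -/(deg e3 x) -/(deg e3 z) => le.
  have := dge x; have := dge z; have := cardsC (unmatched p); rewrite cV; lia.
have hubs x : x \in unmatched p -> x \in H -> deg e3 x <= #|H :\: unmatched p|.
  move=> xU xH; rewrite /deg -(card_imset _ (inv_inj pK)).
  apply/subset_leq_card/subsetP => _ /imsetP[a + ->]; rewrite inE => xa.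
  have aU := cov _ _ xU xa.
  rewrite in_setD pU aU /=; apply: contraT => paH.
  have [q [qm qU qc]] := rot _ _ xU xa.
  have := Hmin q qm qc.
  have -> : unmatched q :&: H = (unmatched p :&: H) :\ x.
    apply/setP => v; rewrite qU !in_setI in_setU1 !in_setD1 in_setI.
    have [->|_] := eqVneq v (p a); last by rewrite andbA.
    by rewrite (negPf paH) !andbF.
  by rewrite (cardsD1 x (_ :&: _)) in_setI xU xH; lia.
have [x [y [xUH yUH xy]]] :
    exists x y, [/\ x \in unmatched p :&: H, y \in unmatched p :&: H & x != y].
  (* Otherwise two uncovered vertices have [e2]-degree at most [k.-1], and the sum of these degrees
     is at most [t], against [dsum]. *)
  apply/card_gt1P; rewrite ltnNge; apply/negP => UH1.
  have /card_gt1P[x [z [xL zL xz]]] : 1 < #|unmatched p :\: H|.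
    by have := cardsID H (unmatched p); lia.
  move: xL zL; rewrite !in_setD !(in_set (fun v => k <= _)) -!ltnNge.
  move=> /andP[xk xU] /andP[zk zU].
  by have := dsum _ _ xU zU xz; lia.
move: xUH yUH; rewrite !in_setI => /andP[xU xH] /andP[yU yH].
have hx := hubs _ xU xH; have hy := hubs _ yU yH.
have hxy : #|H :\: unmatched p| <= #|H :\ x :\ y|.
  apply/subset_leq_card/subsetP => v; rewrite !in_setD !in_set1.
  by case/andP=> vU ->; rewrite andbT; apply/andP; split; apply: contraNneq vU => ->.
have Hsum : \sum_(v in H) (deg e2 v).+1 <= #|V|.
  apply: sum_closed_nbh => // v; rewrite inE => kv.
  by split; [lia | move=> u; apply: hub].
move: Hsum; rewrite (bigD1 x) //= (bigD1 y) /=; last by rewrite yH eq_sym.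
have : #|H :\ x :\ y| * k.+1 <=
    \sum_(v | (v \in H) && (v != x) && (v != y)) (deg e2 v).+1.
  rewrite -sum_nat_const.
  rewrite [X in _ <= X](eq_bigl [in H :\ x :\ y]); last first.
    by move=> v; rewrite !inE; case: (v == x); case: (v == y); rewrite ?andbT ?andbF.
  by apply: leq_sum => v; rewrite !inE => /and3P[_ _]; rewrite ltnS.
move: (\sum_(v | _) _) => S.
(* With [h] hubs besides [x] and [y], each of these two has a closed [e2]-neighbourhood of size at
   least [2 * t - h]. The total is then at least [4 * t - 2 * h + 3 * h], more than [3 * t]. *)
have := dge x; have := dge y; rewrite cV.
have : #|H :\ x :\ y| * 3 <= #|H :\ x :\ y| * k.+1 by rewrite leq_mul2l; lia.
have : 0 < t by lia.
lia.
Qed.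

(** * Colour classes without red cherries and green paths *)

Section Colorings.
Variables (t : nat) (c : {set complete_multipartite 3 t} -> 'I_3).
Local Notation V := (complete_multipartite 3 t).
Implicit Types (i : 'I_3) (u v w x y z : V).

Definition col i : rel V := fun u v => (u.1 != v.1) && (c [set u; v] == i).

Definition color (k : nat) (k3 : k < 3) : rel V := col (Ordinal k3).
Local Notation red := (@color 0 isT).
Local Notation green := (@color 1 isT).
Local Notation blue := (@color 2 isT).

Lemma color_sym k (k3 : k < 3) : symmetric (color k3).
Proof. by move=> u v; rewrite /color /col eq_sym setUC. Qed.

Lemma color_irr k (k3 : k < 3) : irreflexive (color k3).
Proof. by move=> u; rewrite /color /col eqxx. Qed.

Lemma color_adj k (k3 : k < 3) u v : color k3 u v -> u.1 != v.1.
Proof. by case/andP. Qed.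

Lemma color_cases u v : u.1 != v.1 -> [\/ red u v, green u v | blue u v].
Proof.
rewrite /color /col => ->; case: (c _) => [[|[|[|//]]] k3].
- by constructor 1.
- by constructor 2.
- by constructor 3.
Qed.

Lemma cherry_copy (k : 'I_3) u v w : v != w -> col k u v -> col k u w ->
  mono_copy c k (complete_bipartite 1 2).
Proof.
move=> vw uv uw.
have irr y z : col k y z -> y <> z by move=> + E; rewrite E /col eqxx.
have adj_col y z : col k y z -> adj y z /\ c [set y; z] = k.
  by case/andP=> ? /eqP.
have adj_col' y z : col k y z -> adj z y /\ c [set z; y] = k.
  by rewrite setUC adj_sym; apply: adj_col.
exists (fun x : 'I_1 + 'I_2 =>
          match x with inl _ => u | inr j => if val j == 0 then v else w end).
  move=> [p|p] [q|q] /=; first by rewrite (ord1 p) (ord1 q).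
  - by case: ifP => _ E; [case: (irr _ _ uv) | case: (irr _ _ uw)].
  - by case: ifP => _ E; [case: (irr _ _ uv) | case: (irr _ _ uw)].
  case: p q => [[|[|//]] p] [[|[|//]] q] /=; do ?[by move=> E; rewrite E eqxx in vw];
    by move=> _; congr inr; apply: val_inj.
move=> [p|p] [q|q] //= _; first by case: ifP => _; apply: adj_col.
by case: ifP => _; apply: adj_col'.
Qed.

Lemma path4_copy (k : 'I_3) u v w x : uniq [:: u; v; w; x] ->
  col k u v -> col k v w -> col k w x -> mono_copy c k (path_graph 4).
Proof.
move=> us uv vw wx; exists (fun p : 'I_4 => nth u [:: u; v; w; x] p).
  move=> p q /eqP.
  rewrite (@nth_uniq _ u [:: u; v; w; x] p q (ltn_ord p) (ltn_ord q) us).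
  by move=> /eqP/val_inj.
have E (p q : 'I_4) : p.+1 = q ->
    col k (nth u [:: u; v; w; x] p) (nth u [:: u; v; w; x] q).
  by case: p q => [[|[|[|[|?]]]] ?] [[|[|[|[|?]]]] ?] //=.
move=> p q /orP[]/eqP/E/andP[pq /eqP cpq]; first by split.
by rewrite setUC adj_sym; split.
Qed.

Lemma matching_copy (k : 'I_3) n (s : seq (V * V)) : 0 < n <= size s ->
    uniq (unzip1 s ++ unzip2 s) -> all (fun q => col k q.1 q.2) s ->
  mono_copy c k (matching_graph n).
Proof.
case/andP=> n_gt0 ns us sk.
have u0 : V * V by case: s ns {us sk} => // ns; rewrite leqNgt n_gt0 in ns.
have lt_s (p : 'I_n) : p < size s := leq_trans (ltn_ord p) ns.
(* The ends of edge [p] sit at positions [p] and [p + size s] of the concatenation, so injectivity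
   follows from [us]. *)
pose f (p : 'I_n * bool) :=
  nth u0.1 (unzip1 s ++ unzip2 s) (p.1 + p.2 * size s).
have ff p : f (p, false) = (nth u0 s p).1.
  by rewrite /f /= addn0 nth_cat size_map lt_s (nth_map u0).
have ft p : f (p, true) = (nth u0 s p).2.
  rewrite /f /= mul1n nth_cat size_map ltnNge leq_addl /= addnK.
  by rewrite (nth_map u0) // (set_nth_default u0.1).
exists f.
  move=> [p b] [q d] /eqP; rewrite nth_uniq //; last first.
  - by rewrite size_cat !size_map; have := lt_s q; case: d => /=; lia.
  - by rewrite size_cat !size_map; have := lt_s p; case: b => /=; lia.
  move=> /eqP E; have [pq bd] : val p = val q /\ b = d.
    by move: (lt_s p) (lt_s q) E => /=; case: b; case: d => /=; lia.
  by rewrite (val_inj pq) bd.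
have edge p : col k (f (p, false)) (f (p, true)).
  by rewrite ff ft; apply: (allP sk); apply: mem_nth.
move=> [p b] [q d] /andP[/= /eqP <-].
have /andP[adj_p /eqP col_p] := edge p.
case: b; case: d => // _.
by rewrite setUC multipartite_adj_sym.
Qed.

Lemma color_degrees v : deg red v + deg green v + deg blue v = 2 * t.
Proof.
have nbhE : [set u : V | v.1 != u.1] = nbh red v :|: nbh green v :|: nbh blue v.
  apply/setP => u; rewrite !inE; apply/idP/idP => [/color_cases[]->|]; rewrite ?orbT //.
  by case/orP=> [/orP[]|]; exact: color_adj.
have dis k k' (k3 : k < 3) (k3' : k' < 3) : k != k' ->
    nbh (color k3) v :&: nbh (color k3') v = set0.
  move=> kk; apply/setP => u; rewrite !inE; apply/negP.
  case/andP=> /andP[_ /eqP cE] /andP[_]; rewrite cE => /eqP[E].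
  by rewrite E eqxx in kk.
have : #|[set u : V | v.1 != u.1]| = 2 * t.
  have -> : [set u : V | v.1 != u.1] = ~: setX [set v.1] setT.
    by apply/setP => u; rewrite !inE andbT eq_sym.
  by rewrite cardsCs setCK cardsX cards1 cardsT card_prod !card_ord; lia.
by rewrite nbhE !cardsU setIUl !dis // set0U cards0 !subn0.
Qed.

Hypothesis no_cherry : forall u v w, red u v -> red u w -> v = w.
Hypothesis no_path : forall u v w x, green u v -> green v w -> green w x ->
  u != w -> v != x -> u = x.

Lemma red_deg v : deg red v <= 1.
Proof.
apply/card_le1_eqP => x y; rewrite !inE => vx vy.
exact: no_cherry vy vx.
Qed.

Lemma green_hub v u :
    2 < deg green v \/ 1 < deg green v /\
      (forall x y z, green x y -> green y z -> ~~ green x z) ->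
  green v u -> deg green u <= 1.
Proof.
move=> hv vu; rewrite leqNgt; apply/negP => u2.
have uv : green u v by rewrite color_sym.
have [w uw wv] : exists2 w, green u w & w != v.
  move: u2; rewrite /deg (cardsD1 v) inE uv ltnS => /card_gt0P[w].
  by rewrite !inE => /andP[]; exists w.
have [x vx /andP[xu xw]] : exists2 x, green v x & (x != u) && (x != w).
  case: hv => [v3|[v2 notri]].
    have : 0 < #|nbh green v :\ u :\ w|.
      move: v3; rewrite /deg (cardsD1 u) (cardsD1 w); lia.
    by case/card_gt0P => x; rewrite !inE => /and3P[]; exists x => //; apply/andP.
  move: v2; rewrite /deg (cardsD1 u) inE vu ltnS => /card_gt0P[x].
  rewrite !inE => /andP[xu vx]; exists x; rewrite // xu /=.
  by apply: contraTneq uw => <-; apply: notri uv vx.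
have wu : green w u by rewrite color_sym.
have := no_path wu uv vx wv; rewrite eq_sym xu => /(_ isT) wx.
by rewrite wx eqxx in xw.
Qed.

Lemma blue_of_two u v w : v != w -> u.1 != v.1 -> u.1 != w.1 ->
  ~~ green u v -> ~~ green u w -> blue u v \/ blue u w.
Proof.
move=> vw auv auw /negPf guv /negPf guw.
case: (color_cases auv); rewrite ?guv //; last by left.
case: (color_cases auw); rewrite ?guw //; last by right.
by move=> rw rv; rewrite (no_cherry rw rv) eqxx in vw.
Qed.

Lemma green_triangle x y z w : green x y -> green y z -> green x z ->
  w != y -> w != z -> ~~ green x w.
Proof.
move=> xy yz xz wy wz; apply/negP; rewrite color_sym => wx.
have xz' : x != z by apply: contraTneq xz => ->; rewrite color_irr.
by move: wz; rewrite (no_path wx xy yz wy xz') eqxx.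
Qed.

Lemma red_of_cycle4 x y z w : x.1 != y.1 -> y.1 != z.1 -> z.1 != w.1 ->
    w.1 != x.1 -> x != z -> y != w ->
    ~~ blue x y -> ~~ blue y z -> ~~ blue z w -> ~~ blue w x ->
  red x y \/ red x w.
Proof.
move=> axy ayz azw awx xz yw /negPf bxy /negPf byz /negPf bzw /negPf bwx.
case: (color_cases axy); rewrite ?bxy //; first by left.
case: (color_cases awx); rewrite ?bwx //; first by rewrite color_sym; right.
move=> gwx gxy.
have gyx : green y x by rewrite color_sym.
have gxw : green x w by rewrite color_sym.
case: (color_cases ayz); rewrite ?byz //; last first.
  move=> gyz; have := no_path gwx gxy gyz; rewrite eq_sym => /(_ yw xz) E.
  by rewrite E eqxx in azw.
case: (color_cases azw); rewrite ?bzw //; last first.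
  rewrite color_sym => gwz; have E := no_path gyx gxw gwz yw xz.
  by rewrite E eqxx in ayz.
rewrite (color_sym _ y) => zw zy.
by rewrite (no_cherry zy zw) eqxx in yw.
Qed.

Section GreenTriangle.
Variables (i j l : 'I_3) (a b d : 'I_t).
Hypotheses (ij : i != j) (jl : j != l) (il : i != l).
Let x : V := (i, a).
Let y : V := (j, b).
Let z : V := (l, d).
Hypotheses (xy : green x y) (yz : green y z) (xz : green x z).

Lemma blue_from_triangle v u w : v \in [:: x; y; z] -> u != w ->
    u \notin [:: x; y; z] -> w \notin [:: x; y; z] ->
    v.1 != u.1 -> v.1 != w.1 ->
  blue v u \/ blue v w.
Proof.
move=> vT uw uT wT; have gT q : q \notin [:: x; y; z] -> ~~ green v q.
  have [yx zy zx] : [/\ green y x, green z y & green z x].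
    by split; rewrite color_sym.
  rewrite !inE !negb_or => /and3P[qx qy qz].
  move: vT; rewrite !inE => /or3P[]/eqP->.
  - exact: green_triangle xy yz xz qy qz.
  - exact: green_triangle yx xz yz qx qz.
  - exact: green_triangle zx xy zy qx qy.
by move=> vu vw; apply: blue_of_two => //; apply: gT.
Qed.

Lemma blue_matching2 a1 b1 d1 : a1 != a -> b1 != b -> d1 != d ->
  exists s : seq (V * V),
    [/\ size s = 2, uniq (unzip1 s ++ unzip2 s) & all (fun q => blue q.1 q.2) s].
Proof.
move=> /negPf aa /negPf bb /negPf dd.
have nE := (negPf ij, negPf jl, negPf il, aa, bb, dd, eq_sym j i, eq_sym l j,
            eq_sym l i, eq_sym a a1, eq_sym b b1, eq_sym d d1, eqxx).
pose x1 : V := (i, a1); pose y1 : V := (j, b1); pose z1 : V := (l, d1).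
have T2 v u w := @blue_from_triangle v u w.
have [bx|bx] : blue x y1 \/ blue x z1.
  by apply: T2; rewrite ?inE ?xpair_eqE ?nE.
- have [by_|by_] : blue y x1 \/ blue y z1.
    by apply: T2; rewrite ?inE ?xpair_eqE ?nE.
  + by exists [:: (x, y1); (y, x1)]; rewrite /= bx by_ !inE !xpair_eqE !nE.
  + by exists [:: (x, y1); (y, z1)]; rewrite /= bx by_ !inE !xpair_eqE !nE.
- have [bz|bz] : blue z x1 \/ blue z y1.
    by apply: T2; rewrite ?inE ?xpair_eqE ?nE.
  + by exists [:: (x, z1); (z, x1)]; rewrite /= bx bz !inE !xpair_eqE !nE.
  + by exists [:: (x, z1); (z, y1)]; rewrite /= bx bz !inE !xpair_eqE !nE.
Qed.

Lemma blue_matching4_of_edge a1 a2 b1 b2 d1 d2 :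
    uniq [:: a; a1; a2] -> uniq [:: b; b1; b2] -> uniq [:: d; d1; d2] ->
    blue (i, a1) (j, b1) ->
  exists s : seq (V * V),
    [/\ size s = 4, uniq (unzip1 s ++ unzip2 s) & all (fun q => blue q.1 q.2) s].
Proof.
rewrite /= !inE !negb_or !andbT.
move=> /andP[/andP[/negPf aa1 /negPf aa2] /negPf a12].
move=> /andP[/andP[/negPf bb1 /negPf bb2] /negPf b12].
move=> /andP[/andP[/negPf dd1 /negPf dd2] /negPf d12] e.
have nE := (negPf ij, negPf jl, negPf il, aa1, aa2, a12, bb1, bb2, b12, dd1, dd2,
  d12, (eq_sym j i, eq_sym l j, eq_sym l i, eq_sym a1 a, eq_sym a2 a,
  eq_sym a2 a1, eq_sym b1 b, eq_sym b2 b, eq_sym b2 b1, eq_sym d1 d,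
  eq_sym d2 d, eq_sym d2 d1), eqxx).
pose x1 : V := (i, a1); pose y1 : V := (j, b1); pose z1 : V := (l, d1).
pose x2 : V := (i, a2); pose y2 : V := (j, b2); pose z2 : V := (l, d2).
have matching v w u : let s := [:: (z, v); (y, w); (x, u); (x1, y1)] in
    uniq (unzip1 s ++ unzip2 s) -> blue z v -> blue y w -> blue x u ->
  exists s : seq (V * V),
    [/\ size s = 4, uniq (unzip1 s ++ unzip2 s) & all (fun q => blue q.1 q.2) s].
  by move=> s us zv yw xu; exists s; split=> //=; rewrite zv yw xu e.
have T2 v u w := @blue_from_triangle v u w.
have [bz|bz] : blue z x2 \/ blue z y2.
  by apply: T2; rewrite ?inE ?xpair_eqE ?nE.
- have [by_|by_] : blue y z1 \/ blue y z2.
    by apply: T2; rewrite ?inE ?xpair_eqE ?nE.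
  + case: (T2 x y2 z2); rewrite ?inE ?xpair_eqE ?nE // => bx;
      by apply: matching bz by_ bx; rewrite /= !inE !xpair_eqE !nE.
  + case: (T2 x y2 z1); rewrite ?inE ?xpair_eqE ?nE // => bx;
      by apply: matching bz by_ bx; rewrite /= !inE !xpair_eqE !nE.
- have [bx|bx] : blue x z1 \/ blue x z2.
    by apply: T2; rewrite ?inE ?xpair_eqE ?nE.
  + case: (T2 y x2 z2); rewrite ?inE ?xpair_eqE ?nE // => by_;
      by apply: matching bz by_ bx; rewrite /= !inE !xpair_eqE !nE.
  + case: (T2 y x2 z1); rewrite ?inE ?xpair_eqE ?nE // => by_;
      by apply: matching bz by_ bx; rewrite /= !inE !xpair_eqE !nE.
Qed.

End GreenTriangle.

(* Were no edge between these vertices blue, the 4-cycles through [(i, a1)] would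
   give it red edges to both other classes. *)
Lemma blue_matching4 (i j l : 'I_3) (a b d a1 a2 b1 b2 d1 d2 : 'I_t) :
    i != j -> j != l -> i != l ->
    green (i, a) (j, b) -> green (j, b) (l, d) -> green (i, a) (l, d) ->
    uniq [:: a; a1; a2] -> uniq [:: b; b1; b2] -> uniq [:: d; d1; d2] ->
  exists s : seq (V * V),
    [/\ size s = 4, uniq (unzip1 s ++ unzip2 s) & all (fun q => blue q.1 q.2) s].
Proof.
move=> ij jl il xy yz xz ua ub ud.
have lj : l != j by rewrite eq_sym.
have zy : green (l, d) (j, b) by rewrite color_sym.
have swap (e e1 e2 : 'I_t) : uniq [:: e; e1; e2] -> uniq [:: e; e2; e1].
  rewrite /= !inE !negb_or !andbT => /andP[/andP[-> ->] ne].
  by rewrite eq_sym.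
have ua' := swap _ _ _ ua; have ub' := swap _ _ _ ub; have ud' := swap _ _ _ ud.
have edgeY p p' q q' : uniq [:: a; p; p'] -> uniq [:: b; q; q'] ->
    blue (i, p) (j, q) -> _ :=
  fun up uq => blue_matching4_of_edge ij jl il xy yz xz up uq ud.
have edgeZ p p' q q' : uniq [:: a; p; p'] -> uniq [:: d; q; q'] ->
    blue (i, p) (l, q) -> _ :=
  fun up uq => blue_matching4_of_edge il lj ij xz zy xy up uq ub.
have ne (e e1 e2 : 'I_t) : uniq [:: e; e1; e2] -> e1 != e2.
  by rewrite /= !inE => /and3P[].
have cyc (k : 'I_3) p q : i != k -> p != q ->
    [\/ blue (i, a1) (k, p), blue (i, a1) (k, q), blue (i, a2) (k, p)
      | blue (i, a2) (k, q)] \/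
    (exists m, red (i, a1) (k, m)).
  move=> ik pq.
  have [?|n1] := boolP (blue (i, a1) (k, p)); first by left; constructor 1.
  have [?|n2] := boolP (blue (i, a1) (k, q)); first by left; constructor 2.
  have [?|n3] := boolP (blue (i, a2) (k, p)); first by left; constructor 3.
  have [?|n4] := boolP (blue (i, a2) (k, q)); first by left; constructor 4.
  right; have ki : k != i by rewrite eq_sym.
  have [] : red (i, a1) (k, p) \/ red (i, a1) (k, q).
    apply: (@red_of_cycle4 _ _ (i, a2)) => //.
    - by rewrite xpair_eqE (negPf (ne _ _ _ ua)) andbF.
    - by rewrite xpair_eqE (negPf pq) andbF.
    - by rewrite color_sym.
    - by rewrite color_sym.
  - by exists p.
  - by exists q.
have [[]|[m rm]] := cyc j b1 b2 ij (ne _ _ _ ub).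
- exact: edgeY ua ub.
- exact: edgeY ua ub'.
- exact: edgeY ua' ub.
- exact: edgeY ua' ub'.
have [[]|[m' rm']] := cyc l d1 d2 il (ne _ _ _ ud).
- exact: edgeZ ua ud.
- exact: edgeZ ua ud'.
- exact: edgeZ ua' ud.
- exact: edgeZ ua' ud'.
have [E _] := no_cherry rm rm'.
by rewrite E eqxx in jl.
Qed.


(* With [k = 3] the vertices of green degree at least [k] are centres of green
   stars without further ado, but [2 * k.-1 <= t] requires [3 < t]; with [k = 2]
   green triangles have to be excluded. *)
Lemma blue_matching_no_triangle : 1 < t ->
    (3 < t \/ forall x y z, green x y -> green y z -> ~~ green x z) ->
  exists2 p, is_matching blue p & #|unmatched p| <= 2.
Proof.
move=> t1 tri; have [k [k1 kt hub]] : exists k, [/\ 1 < k, 2 * k.-1 <= t &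
    forall v u, k <= deg green v -> green v u -> deg green u <= 1].
  case: tri => [t3|notri].
    by exists 3; split=> // v u v3; apply: green_hub; left.
  by exists 2; split=> // v u v2; apply: green_hub; right.
apply: (near_perfect_matching (e2 := green) (t := t) (k := k)) => //.
- exact: color_sym.
- exact: color_irr.
- exact: color_sym.
- exact: color_irr.
- by rewrite card_prod !card_ord.
- by move=> v; have := color_degrees v; have := red_deg v; lia.
Qed.

Lemma blue_copy n : 1 < n -> t = (2 * n) %/ 3 + 1 ->
  mono_copy c (Ordinal (isT : 2 < 3)) (matching_graph n).
Proof.
move=> n1 tE; have t1 : 1 < t by lia.
have copy (p : {ffun V -> V}) : is_matching blue p -> #|unmatched p| <= 2 ->
    mono_copy c (Ordinal (isT : 2 < 3)) (matching_graph n).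
  move=> pm pU; have [A [cA Ae Ap]] := matching_half pm.
  have cV : #|V| = 3 * t by rewrite card_prod !card_ord.
  apply: (@matching_copy _ _ [seq (v, p v) | v <- enum A]).
  - by rewrite size_map -cardE; lia.
  - rewrite /unzip1 /unzip2 -!map_comp map_id cat_uniq.
    rewrite (map_inj_uniq (inv_inj (matchingK pm))) enum_uniq andbT /=.
    apply/hasPn => _ /mapP[v vA ->] /=; apply/negP => pvA.
    by move: vA pvA; rewrite !mem_enum => vA pvA; have := Ap _ _ pvA vA; rewrite eqxx.
  - by rewrite all_map; apply/allP => v; rewrite mem_enum; apply: Ae.
have [t3|t3] := ltnP 3 t.
  by have [p] := blue_matching_no_triangle t1 (or_introl t3); apply: copy.
pose tri x y z := [&& green x y, green y z & green x z].
have [|/existsPn notri] := boolP [exists x, exists y, exists z, tri x y z]; last first.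
  have [|p] := blue_matching_no_triangle t1; last exact: copy.
  right=> x y z xy yz; have /existsPn/(_ y)/existsPn/(_ z) := notri x.
  by rewrite /tri xy yz.
case/existsP=> -[i a] /existsP[[j b]] /existsP[[l d]] /and3P[xy yz xz].
have ij := color_adj xy; have jl := color_adj yz; have il := color_adj xz.
have [t2|t2] := ltnP 2 t.
  have n4 : 0 < n <= 4 by lia.
  have others (e : 'I_t) : exists e1 e2, uniq [:: e; e1; e2].
    have /card_gt1P[e1 [e2 []]] : 1 < #|[set~ e]|.
      by rewrite cardsC1 card_ord; lia.
    rewrite !inE => ee1 ee2 e12; exists e1, e2.
    by rewrite /= !inE !(eq_sym e) (negPf ee1) (negPf ee2) e12.
  have [a1 [a2 ua]] := others a; have [b1 [b2 ub]] := others b.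
  have [d1 [d2 ud]] := others d.
  have [s [sz su sb]] := blue_matching4 ij jl il xy yz xz ua ub ud.
  by apply: (@matching_copy _ _ s); rewrite // sz.
have n2 : 0 < n <= 2 by lia.
have other (e : 'I_t) : exists e1, e1 != e.
  have /card_gt0P[e1] : 0 < #|[set~ e]| by rewrite cardsC1 card_ord; lia.
  by rewrite !inE; exists e1.
have [a1 ua] := other a; have [b1 ub] := other b; have [d1 ud] := other d.
have [s [sz su sb]] := blue_matching2 ij jl il xy yz xz ua ub ud.
by apply: (@matching_copy _ _ s); rewrite // sz.
Qed.

End Colorings.

Lemma arrows_upper n : 1 < n ->
  arrows (complete_multipartite 3 ((2 * n) %/ 3 + 1))
    (graphs3 (complete_bipartite 1 2) (path_graph 4) (matching_graph n)).
Proof.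
move=> n1 c; set t := (2 * n) %/ 3 + 1 in c *.
pose cherry u v w := [&& color c (isT : 0 < 3) u v, color c (isT : 0 < 3) u w & v != w].
pose path u v w x := [&& color c (isT : 1 < 3) u v, color c (isT : 1 < 3) v w,
  color c (isT : 1 < 3) w x & uniq [:: u; v; w; x]].
have [|/existsPn nocherry] := boolP [exists u, exists v, exists w, cherry u v w].
  case/existsP=> u /existsP[v /existsP[w /and3P[uv uw vw]]].
  by exists (Ordinal (isT : 0 < 3)); apply: cherry_copy vw uv uw.
have [|/existsPn nopath] :=
    boolP [exists u, exists v, exists w, exists x, path u v w x].
  case/existsP=> u /existsP[v /existsP[w /existsP[x /and4P[uv vw wx us]]]].
  by exists (Ordinal (isT : 1 < 3)); apply: path4_copy us uv vw wx.
exists (Ordinal (isT : 2 < 3)); apply: blue_copy => //.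
- move=> u v w uv uw; apply/eqP; apply: contraT => vw.
  have /existsPn/(_ v)/existsPn/(_ w) := nocherry u.
  by rewrite /cherry uv uw vw.
- move=> u v w x uv vw wx uw vx; apply/eqP; apply: contraT => ux.
  have /existsPn/(_ v)/existsPn/(_ w)/existsPn/(_ x) := nopath u.
  rewrite /path uv vw wx /= !inE !negb_or uw vx ux !andbT.
  have ne y z : color c (isT : 1 < 3) y z -> y != z.
    by apply: contraTneq => ->; rewrite color_irr.
  by rewrite !ne.
Qed.

(* All edges at one vertex get colour 1 (a star has no [P_4]), the others
   colour 2; the latter leave only [3 * s - 1] vertices for the matching. *)
Lemma arrows_lower n s : 0 < s ->
  arrows (complete_multipartite 3 s)
    (graphs3 (complete_bipartite 1 2) (path_graph 4) (matching_graph n)) ->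
  2 * n < 3 * s.
Proof.
move=> s_gt0 arr; pose v0 : complete_multipartite 3 s := (ord0, Ordinal s_gt0).
pose c (S : {set complete_multipartite 3 s}) :=
  if v0 \in S then Ordinal (isT : 1 < 3) else Ordinal (isT : 2 < 3).
have [[[|[|[|//]]] k3] [f f_inj fP]] := arr c.
- have [_] := fP (inl ord0) (inr ord0) isT.
  by rewrite /c; case: ifP => _ /(congr1 val).
- have edge (p q : 'I_4) : p.+1 = q -> v0 \in [set f p; f q].
    move=> pq; have [|_] := fP p q; first by rewrite /= /path_adj pq eqxx.
    by rewrite /c; case: ifP => // _ /(congr1 val).
  have := edge (@Ordinal 4 0 isT) (@Ordinal 4 1 isT) erefl.
  have := edge (@Ordinal 4 2 isT) (@Ordinal 4 3 isT) erefl.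
  rewrite !inE => /orP[]/eqP E /orP[]/eqP E';
    by have := f_inj _ _ (etrans (esym E) E') => /(congr1 val).
- have fv0 x : f x != v0.
    case: x => p b; have [|_] := fP (p, b) (p, ~~ b).
      by rewrite /= /matching_adj eqxx; case: b.
    by rewrite /c !inE eq_sym; case: eqP => //= _ /(congr1 val).
  have : #|[set f x | x in [set: 'I_n * bool]]| <= #|[set~ v0]|.
    by apply/subset_leq_card/subsetP => _ /imsetP[x _ ->]; rewrite !inE.
  rewrite card_imset // cardsT cardsC1 !card_prod !card_ord card_bool.
  lia.
Qed.

Theorem theorem5 (n : nat) (hn : 2 <= n) :
  is_multipartite_ramsey 3
    (graphs3 (complete_bipartite 1 2) (path_graph 4) (matching_graph n))
    ((2 * n) %/ 3 + 1).
Proof.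
split; [by rewrite addn1 | exact: arrows_upper |].
by move=> s s_gt0 /(arrows_lower s_gt0); lia.
Qed.
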